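(* Let $p\ge 2$ be an integer and $q=1/p$. Then the measure of irrationality of $\zeta_q(1)$ satisfies $$r(\zeta_q(1))\le \frac{3\pi^2}{\pi^2-4}.$$
   Context: $\zeta_q(1)=\sum_{n=1}^\infty \frac{q^n}{1-q^n}=\sum_{n=1}^\infty\frac{1}{p^n-1}$. For a real number $x$, the measure of irrationality is $$r(x)=\inf\{r\in\mathbb{R}: |x-a/b|<1/b^r \text{ has at most finitely many integer solutions } (a,b) \text{ with } b>0\}.$$ *)

(* Defs.v *)
From HB Require Import structures.
From mathcomp Require Import all_boot all_order all_algebra.
From mathcomp Require Import all_classical all_reals all_analysis.
Import Order.TTheory GRing.Theory Num.Theory.
Import numFieldNormedType.Exports.

Set Implicit Arguments.
Unset Strict Implicit.
Unset Printing Implicit Defensive.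

Local Open Scope classical_set_scope.
Local Open Scope ring_scope.

(* The sum over n >= 1 of q^n / (1 - q^n), meaningful where the partial sums
   converge; is_cvg_zeta_q1 below shows that they do for 0 <= q < 1. *)
Definition zeta_q1 (R : realType) (q : R) : R :=
  limn (fun N : nat => \sum_(1 <= n < N) q ^+ n / (1 - q ^+ n)).

(* Pairs (a, b) are not required to be coprime. *)
Definition approx_solutions (R : realType) (x r : R) : set (int * int) :=
  [set ab | 0 < ab.2 /\
            `|x - ab.1%:~R / ab.2%:~R| < 1 / ((ab.2%:~R : R) `^ r)].

(* The infimum is taken in the extended reals, so that it is +oo when no
   exponent r qualifies (Liouville numbers, and also rational x, because
   non-reduced fractions count as distinct solutions). *)
Definition irrationality_measure (R : realType) (x : R) : \bar R :=
  ereal_inf [set r%:E | r in [set r : R | finite_set (approx_solutions x r)]].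

Lemma is_cvg_zeta_q1 (R : realType) (q : R) : 0 <= q < 1 ->
  cvgn (fun N : nat => \sum_(1 <= n < N) q ^+ n / (1 - q ^+ n)).
Proof.
move=> /andP[q0 q1].
have q1' : 0 < 1 - q by rewrite subr_gt0.
have qn n : (0 < n)%N -> 0 < 1 - q ^+ n.
  by move=> n0; rewrite subr_gt0 exprn_ilt1 // -lt0n.
have v0 n : 0 <= (1 - q)^-1 * q ^+ n.
  by apply: mulr_ge0; [rewrite invr_ge0 ltW|exact: exprn_ge0].
pose u n : R := if n is 0%N then 0 else q ^+ n / (1 - q ^+ n).
have cu : cvgn (series u).
  apply: (@series_le_cvg _ u (geometric (1 - q)^-1 q)).
  - case=> [|n] //=; rewrite divr_ge0 ?exprn_ge0 //.
    exact/ltW/qn.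
  - move=> n; exact: v0.
  - case=> [|n] /=; first exact: (v0 0%N).
    rewrite mulrC ler_wpM2r ?exprn_ge0 // lef_pV2 ?posrE ?qn //.
    rewrite lerB // exprS ler_piMr // exprn_ile1 //; exact: ltW.
  - by apply: is_cvg_geometric_series; rewrite ger0_norm.
suff -> : (fun N : nat => \sum_(1 <= n < N) q ^+ n / (1 - q ^+ n)) = series u.
  exact: cu.
apply/funext => -[|N]; rewrite /series /=; first by rewrite !big_geq.
rewrite [RHS]big_ltn // add0r.
by apply: eq_big_nat => -[].
Qed.

(* Main.v *)
Require Import Defs.
From HB Require Import structures.
From mathcomp Require Import all_boot all_order all_algebra.
From mathcomp Require Import all_classical all_reals all_analysis.
From mathcomp Require Import qpoly zify ring lra.
Import Order.TTheory GRing.Theory Num.Theory.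
Import numFieldNormedType.Exports.
Local Open Scope ring_scope.

(** With [x = p] and [q = 1 / p], sum over [T = x, x^2, x^3, ...] the rational function
<<
  r_n(T) = (T - x) ... (T - x^n) / (T^n (T - 1) (x T - 1) ... (x^n T - 1)).
>>
    Its partial fraction coefficients are integers, a pole at [T = x^-j] contributes
    [zeta_q(1)] minus a finite piece of its series, and the pole at [0] contributes the
    rational numbers [1 / (x^i - 1)], [1 <= i <= n].  After multiplication by
    [(x - 1) ... (x^n - 1)] one gets integers [a, c] with [|a| <= x^(2n^2 + O(n))] and
    [a zeta_q(1) - c = x^(-n^2 + O(n))]; this quantity is positive because [r_n] vanishes at
    [x, ..., x^n] and is positive afterwards.  Such forms bound the irrationality measure by
    [3].  The exponent [4] is already below the claimed constant, since [2 < pi <= 4], and it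
    leaves room for crude estimates: the least common multiple of the [x^i - 1], and with it
    the asymptotics of the totient sum, is not needed. *)

(** * Gaussian factorials and binomials *)

Definition qfact (R : pzRingType) (x : R) (n : nat) : R :=
  \prod_(1 <= i < n.+1) (x ^+ i - 1).

(* The Gaussian binomial [j + k choose j] at x, by the q-Pascal rule. *)
Fixpoint qbin (R : pzRingType) (x : R) (j k : nat) {struct k} : R :=
  if k isn't k'.+1 then 1 else
  (fix qbin_row (j : nat) : R :=
     if j isn't j'.+1 then 1 else qbin_row j' + x ^+ j * qbin R x j k') j.

Arguments qbin {R} x j k.
Arguments qfact {R} x n.

Lemma qbin0n (R : pzRingType) (x : R) k : qbin x 0 k = 1.
Proof. by case: k. Qed.

Lemma qbinSS (R : pzRingType) (x : R) j k :
  qbin x j.+1 k.+1 = qbin x j k.+1 + x ^+ j.+1 * qbin x j.+1 k.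
Proof. by []. Qed.

Lemma qfact0 (R : pzRingType) (x : R) : qfact x 0 = 1.
Proof. by rewrite /qfact big_geq. Qed.

Lemma qfactS (R : pzRingType) (x : R) n :
  qfact x n.+1 = qfact x n * (x ^+ n.+1 - 1).
Proof. by rewrite /qfact big_nat_recr. Qed.

(** The q-Pascal rule matches the splitting [x^(j+k+2) - 1 = (x^(j+1) - 1) + x^(j+1) (x^(k+1) - 1)],
    so both induction hypotheses add up. *)
Lemma qbin_fact (R : comPzRingType) (x : R) j k :
  qbin x j k * (qfact x j * qfact x k) = qfact x (j + k).
Proof.
elim: k j => [|k IHk] j; first by rewrite qfact0 mul1r mulr1 addn0.
elim: j => [|j IHj]; first by rewrite qbin0n qfact0 !mul1r.
have {IHk} := IHk j.+1; move: IHj; rewrite qbinSS !addSn !addnS.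
rewrite [qfact x (j + k).+2]qfactS [qfact x k.+1]qfactS [qfact x j.+1]qfactS.
rewrite !exprS exprD; set h := qfact x _.+1 => IHj IHk.
rewrite [RHS](_ : _ = (x * x ^+ j - 1) * h + x * x ^+ j * ((x * x ^+ k - 1) * h)).
  by rewrite -{1}IHj -IHk; ring.
by ring.
Qed.

Lemma qbin_int (R : archiNumDomainType) (x : R) j k :
  x \is a Num.int -> qbin x j k \is a Num.int.
Proof.
move=> xZ; elim: k j => [|k IHk] j; first exact: rpred1.
elim: j => [|j IHj]; first by rewrite qbin0n rpred1.
by rewrite qbinSS rpredD // rpredM // rpredX.
Qed.

Lemma qbin_ge0 (R : numDomainType) (x : R) j k : 0 <= x -> 0 <= qbin x j k.
Proof.
move=> x0; elim: k j => [|k IHk] j; first exact: ler01.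
elim: j => [|j IHj]; first by rewrite qbin0n ler01.
by rewrite qbinSS addr_ge0 // mulr_ge0 // exprn_ge0.
Qed.

(** The degree in [x] is [j * k]; the extra factor [x^k] pays for the sums. In each Pascal step both
    summands are at most [x^(j k + j + 2 k + 1)], and [2 <= x] absorbs the factor 2. *)
Lemma qbin_le (R : numDomainType) (x : R) j k :
  2 <= x -> qbin x j k <= x ^+ (j * k + k).
Proof.
move=> x2; have x1 : 1 <= x by apply: le_trans x2; rewrite ler1n.
have x0 : 0 <= x by apply: le_trans x1; rewrite ler01.
elim: k j => [|k IHk] j; first by rewrite muln0 expr0.
elim: j => [|j IHj]; first by rewrite qbin0n exprn_ege1.
rewrite qbinSS.
apply: (@le_trans _ _ (x * x ^+ (j * k + j + 2 * k + 1))); last first.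
  by rewrite -exprS ler_weXn2l //; lia.
apply: (@le_trans _ _ (2 * x ^+ (j * k + j + 2 * k + 1))); last first.
  by rewrite ler_wpM2r ?exprn_ge0.
rewrite -[2]/(1 + 1) mulrDl !mul1r lerD //.
  by apply: le_trans IHj _; rewrite ler_weXn2l //; lia.
apply: (@le_trans _ _ (x ^+ j.+1 * x ^+ (j.+1 * k + k))).
  by rewrite ler_wpM2l ?exprn_ge0.
by rewrite -exprD ler_weXn2l //; lia.
Qed.

(** * Partial fractions with integral coefficients *)

(** Division by increasing powers: [c] is the power series [p / d] cut off at ['X^n]. It stays over
    [S] because the constant term of [d] is inverted by an element of [S]. *)
Lemma poly_div_Xn (R : comNzRingType) (S : subringClosed R) (p d : {poly R})
    (u : R) (n : nat) :
  p \is a polyOver S -> d \is a polyOver S -> u \in S -> d`_0 * u = 1 ->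
  exists c e : {poly R}, [/\ c \is a polyOver S, (size c <= n)%N &
    p = c * d + e * 'X^n].
Proof.
move=> pS dS uS du.
suff [c [e [cS _ sc pE]]] : exists c e : {poly R}, [/\ c \is a polyOver S,
    e \is a polyOver S, (size c <= n)%N & p = c * d + e * 'X^n].
  by exists c, e.
elim: n => [|n [c [e [cS eS sc pE]]]].
  exists 0, p; rewrite rpred0 size_poly0 mul0r add0r expr0 mulr1.
  by split.
(* The next coefficient of the quotient, chosen so that [e - v *: d] has no constant term. *)
pose v := e`_0 * u.
have vS : v \in S by rewrite rpredM //; apply/polyOverP.
pose f := e - v *: d.
have fS : f \is a polyOver S by rewrite rpredB // polyOverZ.
have fE : f = \poly_(i < size f) f`_i.+1 * 'X.
  apply/polyP => -[|i]; rewrite coefMX /=.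
    by rewrite coefB coefZ /v -mulrA [u * _]mulrC du mulr1 subrr.
  by rewrite coef_poly; case: ltnP => // /leqW h; rewrite nth_default.
exists (c + v *: 'X^n), (\poly_(i < size f) f`_i.+1); split.
- by rewrite rpredD // polyOverZ // polyOverXn.
- by apply/polyOver_poly => i _; apply/polyOverP.
- rewrite (leq_trans (size_polyD _ _)) // geq_max leqW //=.
  by rewrite (leq_trans (size_scale_leq _ _)) // size_polyXn.
- rewrite exprS mulrA -fE /f pE mulrBl mulrDl -scalerAl mulrC.
  by rewrite -!scalerAl -addrA; congr (_ + _); rewrite [d * _]mulrC addrC subrK.
Qed.

(** The factors with [i > j] give [qfact x (n - j)]. Those with [i < j] are
    [- (x^(j-i) - 1) / x^(j-i)], whence the sign, the power [x^(1 + ... + j)] and [qfact x j]. *)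
Lemma prod_powB1 (R : fieldType) (x : R) (n j : nat) :
  x != 0 -> (j <= n)%N ->
  \prod_(i < n.+1 | (i : nat) != j) (x ^+ i / x ^+ j - 1) =
  qfact x (n - j) * ((-1) ^+ j / x ^+ 'C(j.+1, 2) * qfact x j).
Proof.
move=> x0; elim: n => [|n IHn]; [|rewrite leq_eqVlt => /predU1P[->|jn]].
- rewrite leqn0 => /eqP ->; rewrite big_mkcond big_ord_recl big_ord0 /=.
  by rewrite qfact0 divr1 !mul1r.
- rewrite subnn qfact0 mul1r {IHn} big_mkcond big_ord_recr /= eqxx mulr1.
  rewrite -big_mkcond /= (eq_bigl xpredT); last by move=> i /=; rewrite ltn_eqF.
  elim: n.+1 => [|m IHm]; first by rewrite big_ord0 qfact0 divr1 !mul1r.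
  rewrite big_ord_recl /= qfactS.
  under eq_bigr => i _.
    rewrite /bump /= add1n !exprS -mulf_div divff // mul1r; over.
  rewrite IHm (binS m.+1) bin1 exprD !invfM expr0.
  have xm : x ^+ m.+1 != 0 by rewrite expf_neq0.
  by rewrite [in (-1) ^+ m.+1]exprS; field; rewrite xm !expf_neq0.
- rewrite big_mkcond big_ord_recr /=. rewrite -big_mkcond /= IHn // gtn_eqF //.
  by rewrite subSn // qfactS -subSn // expfB //=; ring.
Qed.

(** The two [qbin] are the Gaussian binomials of [n + j] over [j] and of [n] over [j]; in this form
    integrality at an integer [x] is visible. *)
Definition pfrac_coef (R : pzRingType) (x : R) (n j : nat) : R :=
  (-1) ^+ (n + j) * x ^+ 'C(j.+1, 2) * qbin x n j * qbin x (n - j) j.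

Arguments pfrac_coef {R} x n j.

(** This identifies the coefficient of [1 / (x^j T - 1)]: remove that factor from the denominator
    and evaluate at [T = x^-j], where [T^-n] becomes [x^(j n)]. *)
Lemma pfrac_coef_spec (R : fieldType) (x : R) (n j : nat) :
  x != 0 -> (forall i, (0 < i)%N -> x ^+ i != 1) -> (j <= n)%N ->
  \prod_(1 <= i < n.+1) (x ^- j - x ^+ i) * x ^+ (j * n) =
  pfrac_coef x n j * \prod_(i < n.+1 | (i : nat) != j) (x ^+ i / x ^+ j - 1).
Proof.
move=> x0 x1 jn.
have f0 m : qfact x m != 0.
  by rewrite prodf_seq_neq0; apply/allP => i; rewrite mem_index_iota subr_eq0 => /andP[/x1].
(* Each factor times [x^j] is [- (x^(i+j) - 1)], so the product continues [qfact x j] up to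
   [qfact x (n + j)]. *)
have E1 : \prod_(1 <= i < n.+1) (x ^- j - x ^+ i) * x ^+ (j * n) * qfact x j =
  (-1) ^+ n * qfact x (n + j).
  elim: n {jn} => [|m IHm]; first by rewrite big_geq // muln0 !expr0 !mul1r.
  have key : (x ^- j - x ^+ m.+1) * x ^+ j = - (x ^+ (m + j).+1 - 1).
    by rewrite -addSn exprD mulrBl mulVf ?expf_neq0 // opprB.
  rewrite big_nat_recr //= mulnS exprD addSn qfactS [(-1) ^+ m.+1]exprS.
  rewrite [LHS](_ : _ = (\prod_(1 <= i < m.+1) (x ^- j - x ^+ i) *
    x ^+ (j * m) * qfact x j) * ((x ^- j - x ^+ m.+1) * x ^+ j)); last by ring.
  by rewrite IHm key; ring.
apply: (mulIf (f0 j)); rewrite E1 prod_powB1 // /pfrac_coef -qbin_fact.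
rewrite -(subnK jn) -[in qfact x (_ + j)]qbin_fact subnK // exprD.
have xc : x ^+ 'C(j.+1, 2) != 0 by rewrite expf_neq0.
have s2 : (-1) ^+ j * (-1) ^+ j = 1 :> R by rewrite -expr2 sqrr_sign.
rewrite [RHS](_ : _ = (-1) ^+ n * ((-1) ^+ j * (-1) ^+ j) * (qbin x n j *
  (qbin x (n - j) j * (qfact x (n - j) * qfact x j) * qfact x j))).
  by rewrite s2 mulr1.
by field.
Qed.

Definition pfrac_term (R : unitRingType) (x T : R) (n : nat) : R :=
  \prod_(1 <= i < n.+1) (T - x ^+ i) /
  (T ^+ n * \prod_(j < n.+1) (x ^+ j * T - 1)).

Arguments pfrac_term {R} x T n.

(** Writing [N = c D + e X^n] splits [N / (T^n D)] into [c / T^n], the part at the pole 0, and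
    [e / D], which Lagrange interpolation at the points [x^-j] resolves into simple fractions. *)
Lemma pfrac_decomp (R : numFieldType) (S : subringClosed R) (x : R) (n : nat) :
  x \in S -> 1 < x ->
  exists2 c : nat -> R, (forall i, c i \in S) &
    forall T, T != 0 -> (forall j, x ^+ j * T != 1) ->
    pfrac_term x T n = \sum_(j < n.+1) pfrac_coef x n j / (x ^+ j * T - 1) +
                       \sum_(i < n) c i / T ^+ (n - i).
Proof.
move=> xZ x1.
have x0 : x != 0 by rewrite gt_eqF // (lt_trans ltr01).
have xi1 i : (0 < i)%N -> x ^+ i != 1 by move=> i0; rewrite gt_eqF // exprn_egt1 // -lt0n.
pose N : {poly R} := \prod_(1 <= i < n.+1) ('X - (x ^+ i)%:P).
pose D : {poly R} := \prod_(j < n.+1) (x ^+ j *: 'X - 1%:P).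
have NE T : N.[T] = \prod_(1 <= i < n.+1) (T - x ^+ i).
  by rewrite horner_prod; apply: eq_bigr => i _; rewrite hornerXsubC.
have DE T : D.[T] = \prod_(j < n.+1) (x ^+ j * T - 1).
  by rewrite horner_prod; apply: eq_bigr => i _; rewrite !hornerE.
have NZ : N \is a polyOver S.
  by apply: rpred_prod => i _; rewrite rpredB ?polyOverX ?polyOverC ?rpredX.
have DZ : D \is a polyOver S.
  apply: rpred_prod => i _.
  by rewrite rpredB ?polyOverC ?rpred1 // polyOverZ ?polyOverX ?rpredX.
have sN : (size N <= n.+1)%N by rewrite size_prod_XsubC size_iota subSS subn0.
have sD : (size D <= n.+2)%N.
  rewrite (leq_trans (size_prod_leq _ _)) // cardT size_enum_ord leq_subLR.
  have h (i : 'I_n.+1) : true -> (size (x ^+ i *: 'X - 1%:P : {poly R})%R <= 2)%N.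
    move=> _; rewrite (leq_trans (size_polyD _ _)) // geq_max size_polyN.
    rewrite size_polyC oner_eq0 andbT.
    by rewrite (leq_trans (size_scale_leq _ _)) // size_polyX.
  rewrite (leq_trans _ (_ : (n.+1 * 2).+1 <= _)%N) //; last by lia.
  rewrite ltnS (leq_trans (leq_sum _ h)) // sum_nat_const cardT size_enum_ord //.
(* The constant term of [D] is a sign, hence its own inverse. *)
have D0 : D`_0 * (-1) ^+ n.+1 = 1.
  rewrite -horner_coef0 DE (eq_bigr (fun=> -1)); last first.
    by move=> i _; rewrite mulr0 sub0r.
  by rewrite prodr_const card_ord -expr2 sqrr_sign.
have uZ : (-1 : R) ^+ n.+1 \in S by rewrite rpredX // rpredN1.
have [c [e [cZ sc NcD]]] := poly_div_Xn R S N D _ n NZ DZ uZ D0.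
exists (fun i => c`_i) => [i|T T0 xT]; first exact/polyOverP.
have xT0 j : x ^+ j * T - 1 != 0 by rewrite subr_eq0.
(* The [n + 1] nodes determine [e] only if its degree is at most [n]; this follows by comparing
   sizes in [e X^n = N - c D]. *)
have se : (size e <= n.+1)%N.
  have [->|e0] := eqVneq e 0; first by rewrite size_poly0.
  rewrite -(leq_add2l n) -size_mulXn // [e * _](_ : _ = N - c * D); last first.
    by rewrite NcD addrC addKr.
  rewrite (leq_trans (size_polyD _ _)) // geq_max size_polyN.
  have sN2 : (size N <= n + n.+1)%N by apply: leq_trans sN _; rewrite leq_addl.
  rewrite sN2 /=.
  rewrite (leq_trans (size_polyMleq _ _)) // -subn1 leq_subLR.
  by rewrite (leq_trans (leq_add sc sD)) // addnCA addSn leq_add2l addnS.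
pose y j := x ^- j.
have xj0 j : x ^+ j != 0 by rewrite expf_neq0.
have yI : injective y.
  by move=> i j /invr_inj /(ieexprIn (lt_trans ltr01 x1)); apply; rewrite gt_eqF.
(* [D] vanishes at [y j], so only [e X^n] survives there. *)
have ey (j : 'I_n.+1) : e.[y j] = \prod_(1 <= i < n.+1) (y j - x ^+ i) * x ^+ (j * n).
  have := congr1 (fun p => p.[y j]) NcD.
  rewrite /= NE hornerD !hornerM DE (bigD1 j) //= divff // subrr mul0r mulr0.
  by rewrite add0r hornerXn => ->; rewrite /y -mulrA exprVn -exprM mulVf ?mulr1.
have eT : e.[T] / D.[T] = \sum_(j < n.+1) pfrac_coef x n j / (x ^+ j * T - 1).
  rewrite {1}(lagrange_gen (ltn0Sn n) yI se) horner_sum mulr_suml.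
  apply: eq_bigr => j _; rewrite lagrangeE //= !hornerM !hornerC.
  rewrite DE !horner_prod [X in _ / X](bigD1 j) //=.
  under eq_bigr => i _ do rewrite hornerXsubC.
  under [in X in _ * (_ * X) / _]eq_bigr => i _ do rewrite hornerXsubC.
  rewrite ey pfrac_coef_spec //; last by rewrite -ltnS.
  have yy i : i != j -> y j - y i != 0.
    by move=> ij; rewrite subr_eq0 (inj_eq yI) eq_sym.
  rewrite [in LHS](_ : \prod_(i < n.+1 | (i : nat) != j) (x ^+ i / x ^+ j - 1) =
    \prod_(i < n.+1 | i != j) x ^+ i * \prod_(i < n.+1 | i != j) (y j - y i)); last first.
    rewrite -big_split; apply: eq_bigr => i _ /=.
    by rewrite mulrBr /y divff.
  rewrite [X in _ / (_ * X)](_ : _ =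
    \prod_(i < n.+1 | i != j) x ^+ i * \prod_(i < n.+1 | i != j) (T - y i)); last first.
    rewrite -big_split; apply: eq_bigr => i _ /=.
    by rewrite mulrBr /y divff.
  have h1 : \prod_(i < n.+1 | i != j) x ^+ i != 0 by apply/prodf_neq0.
  have h2 : \prod_(i < n.+1 | i != j) (y j - y i) != 0 by apply/prodf_neq0.
  have h3 : \prod_(i < n.+1 | i != j) (T - y i) != 0.
    apply/prodf_neq0 => i _; rewrite -(mulrI_eq0 _ (mulfI (xj0 i))).
    by rewrite mulrBr /y divff.
  by field; rewrite xT0 h1 h2 h3.
rewrite /pfrac_term -NE NcD -DE hornerD !hornerM hornerXn -eT addrC.
have DT0 : D.[T] != 0 by rewrite DE; apply/prodf_neq0.
rewrite mulrDl; congr (_ + _).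
  by field; rewrite DT0 expf_neq0.
rewrite -mulf_div divff // mulr1 (horner_coef_wide _ sc) mulr_suml.
apply: eq_bigr => i _; rewrite -mulrA; congr (_ * _).
by rewrite expfB // invf_div.
Qed.

(** * Size estimates in powers of x *)

Lemma bin2_double n : (2 * 'C(n.+1, 2) = n * n.+1)%N.
Proof. by elim: n => // n IHn; rewrite binS bin1 mulnDr IHn; lia. Qed.

Section PowerBounds.
Variables (R : realFieldType) (x : R).
Hypothesis x2 : 2 <= x.

Let x1 : 1 < x. Proof. by apply: lt_le_trans x2; rewrite ltr1n. Qed.
Let x0 : 0 < x. Proof. exact: lt_trans x1. Qed.
Let xn_gt0 n : 0 < x ^+ n. Proof. exact: exprn_gt0. Qed.
Let xn_le m n : (m <= n)%N -> x ^+ m <= x ^+ n.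
Proof. by move=> mn; rewrite ler_weXn2l // ltW. Qed.

Lemma expn_subr1_ge n : x ^+ n <= x ^+ n.+1 - 1.
Proof.
rewrite lerBrDr exprS; apply: (@le_trans _ _ (2 * x ^+ n)).
  by rewrite -[2]/(1 + 1) mulrDl !mul1r lerD2l exprn_ege1 // ltW.
by rewrite ler_wpM2r // ltW.
Qed.

Lemma qfact_ge n : x ^+ 'C(n, 2) <= qfact x n.
Proof.
elim: n => [|n IHn]; first by rewrite qfact0 bin0n expr0.
rewrite qfactS binS bin1 exprD ler_pM ?exprn_ge0 ?(ltW x0) //.
exact: expn_subr1_ge.
Qed.

Lemma qfact_gt0 n : 0 < qfact x n.
Proof. exact: lt_le_trans (qfact_ge n). Qed.

Lemma qfact_le n : qfact x n <= x ^+ 'C(n.+1, 2).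
Proof.
elim: n => [|n IHn]; first by rewrite qfact0 bin_small // expr0.
rewrite qfactS binS bin1 exprD ler_pM ?(ltW (qfact_gt0 _)) //.
  by apply: le_trans (expn_subr1_ge n); exact: ltW.
by rewrite lerBlDr lerDl.
Qed.

(** The exponent bounding the [j]-th summand times [qfact x n] is largest at [j = n], where it
    equals [2 n^2 + 3 n]; another [x^n] covers the [n + 1] summands. *)
Lemma pfrac_coef_sum_le n :
  `|\sum_(j < n.+1) pfrac_coef x n j| * qfact x n <= x ^+ (2 * n ^ 2 + 4 * n).
Proof.
have le_n : n.+1%:R <= x ^+ n.
  elim: n => [|n IHn]; first by rewrite expr0.
  rewrite exprS; apply: (@le_trans _ _ (2 * x ^+ n)).
    apply: (@le_trans _ _ (2 * n.+1%:R)); first by rewrite -natrM ler_nat; lia.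
    by rewrite ler_pM2l.
  by rewrite ler_wpM2r // ltW.
apply: (@le_trans _ _ (\sum_(j < n.+1) x ^+ (2 * n ^ 2 + 3 * n))); last first.
  rewrite sumr_const card_ord -mulr_natl.
  apply: (@le_trans _ _ (x ^+ n * x ^+ (2 * n ^ 2 + 3 * n))).
    by rewrite ler_wpM2r // ltW.
  by rewrite -exprD xn_le //; lia.
apply: (@le_trans _ _ ((\sum_(j < n.+1) `|pfrac_coef x n j|) * qfact x n)).
  by rewrite ler_wpM2r ?(ltW (qfact_gt0 _)) // ler_norm_sum.
rewrite mulr_suml ler_sum // => -[j /= jn] _.
rewrite /pfrac_coef !normrM normrX normrN1 expr1n mul1r normrX gtr0_norm //.
rewrite !ger0_norm ?qbin_ge0 ?(ltW x0) //.
apply: (@le_trans _ _ (x ^+ 'C(j.+1, 2) * x ^+ (n * j + j) *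
    x ^+ ((n - j) * j + j) * x ^+ 'C(n.+1, 2))).
  by rewrite !ler_pM ?mulr_ge0 ?qbin_ge0 ?qbin_le ?qfact_le ?(ltW (qfact_gt0 _)) ?exprn_ge0 // ltW.
rewrite -!exprD xn_le //.
have := bin2_double j; have := bin2_double n.
move: ('C(_, 2)) ('C(_, 2)) => a b; rewrite ltnS in jn.
rewrite -(subnK jn); move: (n - j)%N => k; rewrite addnK; nia.
Qed.

Lemma pfrac_term_eq0 n t : (0 < t <= n)%N -> pfrac_term x (x ^+ t) n = 0.
Proof.
move=> /andP[t0 tn]; rewrite /pfrac_term (bigD1_seq t) ?iota_uniq //=.
  by rewrite subrr !mul0r.
by rewrite mem_index_iota t0 ltnS.
Qed.

Lemma pfrac_den_ge n t :
  x ^+ ('C(n.+1, 2) + n.+1 * t) <= \prod_(j < n.+1) (x ^+ j * x ^+ t.+1 - 1).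
Proof.
elim: n => [|n IHn].
  by rewrite big_ord_recl big_ord0 mulr1 bin_small // mul1n mul1r expn_subr1_ge.
rewrite big_ord_recr /= -exprD addnS.
rewrite (_ : 'C(n.+2, 2) + n.+2 * t = 'C(n.+1, 2) + n.+1 * t + (n.+1 + t))%N; last first.
  by rewrite binS bin1; lia.
by rewrite exprD ler_pM ?exprn_ge0 ?expn_subr1_ge // ltW.
Qed.

Lemma pfrac_den_le n t :
  \prod_(j < n.+1) (x ^+ j * x ^+ t.+1 - 1) <= x ^+ ('C(n.+1, 2) + n.+1 * t.+1).
Proof.
elim: n => [|n IHn].
  by rewrite big_ord_recl big_ord0 mulr1 bin_small // mul1n mul1r gerBl.
rewrite big_ord_recr /= -exprD addnS.
rewrite (_ : 'C(n.+2, 2) + n.+2 * t.+1 = 'C(n.+1, 2) + n.+1 * t.+1 + (n.+1 + t.+1))%N; last first.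
  by rewrite binS bin1; lia.
rewrite exprD ler_pM //.
- by apply: le_trans (pfrac_den_ge n t); exact: ltW.
- by apply: le_trans (expn_subr1_ge _); exact: ltW.
- by rewrite addnS gerBl.
Qed.

Lemma pfrac_den_gt0 n t : 0 < \prod_(j < n.+1) (x ^+ j * x ^+ t.+1 - 1).
Proof. exact: lt_le_trans (pfrac_den_ge n t). Qed.

Lemma pfrac_term_gt0 n t : (n <= t)%N -> 0 < pfrac_term x (x ^+ t.+1) n.
Proof.
move=> nt; rewrite divr_gt0 // ?mulr_gt0 ?pfrac_den_gt0 ?exprn_gt0 //.
rewrite big_seq prodr_gt0 // => i; rewrite mem_index_iota => /andP[_ ilt].
by rewrite subr_gt0 ltr_eXn2l // (leq_trans ilt).
Qed.

(** The numerator is at most [T^n] and cancels that factor of the denominator. The remaining product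
    has exponent at least ['C(n+1, 2) + (n + 1) (n + t)], and [n (n + 1)] is twice the binomial. *)
Lemma pfrac_term_le n t :
  pfrac_term x (x ^+ (n + t).+1) n <= x ^- (3 * 'C(n.+1, 2) + t).
Proof.
rewrite /pfrac_term ler_pdivrMr ?mulr_gt0 ?pfrac_den_gt0 ?exprn_gt0 //.
set X := x ^+ (n + t).+1.
apply: (@le_trans _ _ (X ^+ n)).
  rewrite -[X in _ <= _ ^+ X](subn1 n.+1) -prodr_const_nat big_seq [leRHS]big_seq.
  apply: ler_prod => i; rewrite mem_index_iota => /andP[_ ilt].
  by rewrite subr_ge0 xn_le ?gerBl ?(ltW (xn_gt0 _)) //; lia.
rewrite mulrCA ler_pMr ?exprn_gt0 // ler_pdivlMl // mulr1.
apply: le_trans (pfrac_den_ge n (n + t)); rewrite xn_le //.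
by have := bin2_double n; move: ('C(_, 2)) => a; nia.
Qed.

(** At [T = x^(n+1)], the first power of [x] past the zeros, each numerator factor [x^(n+1) - x^i]
    is at least [x^n]. *)
Lemma pfrac_term_ge n :
  x ^- (n + 'C(n.+1, 2) + n.+1 ^ 2) <= pfrac_term x (x ^+ n.+1) n.
Proof.
rewrite /pfrac_term ler_pdivlMr ?mulr_gt0 ?pfrac_den_gt0 ?exprn_gt0 //.
rewrite ler_pdivrMl //.
apply: (@le_trans _ _ (x ^+ (n.+1 * n) * x ^+ ('C(n.+1, 2) + n.+1 * n.+1))).
  by rewrite -exprM ler_wpM2l ?pfrac_den_le // ltW.
apply: (@le_trans _ _ (x ^+ (n + 'C(n.+1, 2) + n.+1 ^ 2) * (x ^+ n) ^+ n)).
  by rewrite -exprM -!exprD xn_le //; nia.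
rewrite ler_wpM2l ?(ltW (xn_gt0 _)) //.
rewrite -[X in _ ^+ X <= _](subn1 n.+1) -prodr_const_nat big_seq [leRHS]big_seq.
apply: ler_prod => i; rewrite mem_index_iota => /andP[_ ilt].
rewrite (ltW (xn_gt0 _)) //= lerBrDr exprS.
apply: (@le_trans _ _ (2 * x ^+ n)); last by rewrite ler_wpM2r // ltW.
by rewrite -[2]/(1 + 1) mulrDl !mul1r lerD2l xn_le.
Qed.

End PowerBounds.

(** * Summation and the integer linear forms *)

Lemma qfact_dvd (R : fieldType) (S : subringClosed R) (x : R) (n m : nat) :
  x \in S -> (0 < m <= n)%N -> qfact x n / (x ^+ m - 1) \in S.
Proof.
move=> xS /andP[m0 mn]; have [->|xm] := eqVneq (x ^+ m - 1) 0.
  by rewrite invr0 mulr0 rpred0.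
rewrite /qfact (bigD1_seq m) ?iota_uniq ?mem_index_iota ?m0 ?ltnS //=.
rewrite mulrC mulKf // rpred_prod // => i _.
by rewrite rpredB ?rpred1 // rpredX.
Qed.

Lemma cvg_zeta_q1_series (R : realType) (x : R) : 1 < x ->
  (series (fun m => (x ^+ m - 1)^-1) @ \oo --> zeta_q1 (1 / x))%classic.
Proof.
move=> x1; have x0 : 0 < x by apply: lt_trans x1.
have q01 : 0 <= 1 / x < 1 by rewrite divr_ge0 ?ltW //= ltr_pdivrMr // mul1r.
rewrite (_ : series _ = fun N => \sum_(1 <= n < N) (1 / x) ^+ n / (1 - (1 / x) ^+ n)).
  exact: is_cvg_zeta_q1 q01.
apply/funext => -[|N]; rewrite /series /=; first by rewrite !big_geq.
(* The series starts at [m = 0], where [x^0 - 1 = 0] and the inverse of 0 is 0. *)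
rewrite big_ltn // expr0 subrr invr0 add0r; apply: eq_big_nat => n /andP[n0 _].
have xn : 1 < x ^+ n by rewrite exprn_egt1 // -lt0n.
rewrite expr_div_n expr1n; field; rewrite !subr_eq0 (gt_eqF xn) /=.
by rewrite (gt_eqF (lt_trans _ xn)).
Qed.

Lemma cvg_pfrac_sum (R : realType) (x : R) (n : nat) (a c : nat -> R) :
  1 < x ->
  (\sum_(0 <= t < N) (\sum_(j < n.+1) a j / (x ^+ j * x ^+ t.+1 - 1) +
     \sum_(i < n) c i / x ^+ t.+1 ^+ (n - i)) @[N --> \oo] -->
   (\sum_(j < n.+1) a j) * zeta_q1 (1 / x)
   - \sum_(j < n.+1) a j * \sum_(0 <= m < j.+1) (x ^+ m - 1)^-1
   + \sum_(i < n) c i / (x ^+ (n - i) - 1))%classic.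
Proof.
move=> x1; have x0 : 0 < x by apply: lt_trans x1.
pose h m := (x ^+ m - 1)^-1; pose y i := x ^- (n - i).
(* After exchanging sums, the pole at [x^-j] yields the terms [m = j + 1, ..., j + N] of the zeta
   series, and each power of [1 / T] yields a geometric series. *)
rewrite [X in (X @ _ --> _)%classic](_ : _ = fun N =>
  \sum_(j < n.+1) a j * (series h (N + j.+1)%N - series h j.+1) +
  \sum_(i < n) c i * series (geometric (y i) (y i)) N); last first.
  apply/funext => N; rewrite big_split /= exchange_big [X in _ + X]exchange_big /=.
  congr (_ + _); apply: eq_bigr => i _.
    rewrite -mulr_sumr; congr (_ * _).
    rewrite /series /= [X in _ = X - _](@big_cat_nat _ _ _ i.+1) //=; last first.
      by rewrite leq_addl.
    rewrite addrAC subrr add0r -[in RHS](add0n i.+1) big_addn add0n addnK.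
    by apply: eq_bigr => t _; rewrite -exprD addnC addSnnS.
  rewrite -mulr_sumr; congr (_ * _).
  by apply: eq_bigr => t _; rewrite /y /= -exprS exprVn -!exprM mulnC.
rewrite mulr_suml -sumrB; apply: cvgD.
  apply: cvg_big => [|j _]; first exact: add_continuous.
  rewrite -mulrBr; apply: cvgMl_tmp; apply: cvgB; last exact: cvg_cst.
  by rewrite (cvg_shiftn j.+1 (series h)); exact: cvg_zeta_q1_series.
apply: cvg_big => [|i _]; first exact: add_continuous.
apply: cvgMl_tmp; have xn : 1 < x ^+ (n - i) by rewrite exprn_egt1 // -lt0n subn_gt0.
have xn0 : 0 < x ^+ (n - i) by apply: lt_trans xn.
rewrite (_ : (x ^+ (n - i) - 1)^-1 = y i / (1 - y i)).
  by apply: cvg_geometric_series; rewrite ger0_norm ?invr_ge0 ?ltW // invf_lt1.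
by rewrite /y; field; rewrite !subr_eq0 (gt_eqF xn) (gt_eqF xn0).
Qed.

(** The first [n] terms vanish and the others are positive: the first of them bounds the sum below,
    and a geometric series of ratio [1 / x <= 1 / 2] bounds it above. *)
Lemma pfrac_sum_bounds (R : realType) (x : R) (n N : nat) : 2 <= x -> (n < N)%N ->
  x ^- (n + 'C(n.+1, 2) + n.+1 ^ 2) <=
    \sum_(0 <= t < N) pfrac_term x (x ^+ t.+1) n <= 2 / x ^+ (3 * 'C(n.+1, 2)).
Proof.
move=> x2 nN; have x0 : 0 < x by apply: lt_le_trans x2.
rewrite (@big_cat_nat _ _ _ n) ?(ltnW nN) //= big_nat big1 ?add0r; last first.
  by move=> t tn; rewrite pfrac_term_eq0.
apply/andP; split.
  rewrite big_ltn // (le_trans (pfrac_term_ge _ _ x2 _)) // lerDl.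
  rewrite big_nat sumr_ge0 // => t /andP[nt _].
  by rewrite ltW // pfrac_term_gt0 // ltnW.
rewrite -{1}[n]add0n big_addn.
have -> // : forall u : R,
    series (geometric (x ^- (3 * 'C(n.+1, 2))) x^-1) (N - n)%N <= u ->
    \sum_(0 <= i < N - n) pfrac_term x (x ^+ (i + n).+1) n <= u.
  move=> u; apply: le_trans; rewrite /series /= ler_sum // => t _.
  by rewrite addnC exprVn -invfM -exprD pfrac_term_le.
have xV : x^-1 < 1 by rewrite invf_lt1 //; lra.
apply: le_trans (geometric_le_lim _ _ _ _) _; rewrite ?invr_ge0 ?invr_gt0 ?exprn_ge0 ?(ltW x0) //.
  by rewrite ger0_norm // invr_ge0 ltW.
rewrite mulrC ler_wpM2r ?invr_ge0 ?exprn_ge0 ?(ltW x0) //.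
have xV2 : x^-1 <= 2^-1 by rewrite lef_pV2 ?posrE.
by rewrite invf_ple ?posrE; lra.
Qed.

(** All denominators are of the form [x^m - 1] with [1 <= m <= n], so multiplying by [qfact x n]
    clears them. *)
Lemma zeta_q1_linear_form (R : realType) (p n : nat) (x := p%:R : R) :
  (2 <= p)%N -> exists a c : R, [/\ a \is a Num.int, c \is a Num.int,
    `|a| <= x ^+ (2 * n ^ 2 + 4 * n),
    x ^- (n ^ 2 + 4 * n + 1) <= a * zeta_q1 (1 / x) - c &
    a * zeta_q1 (1 / x) - c <= 2 / x ^+ (n * n.+1)].
Proof.
move=> p2; have x2 : 2 <= x by rewrite ler_nat.
have x1 : 1 < x by apply: lt_le_trans x2; rewrite ltr1n.
have x0 : 0 < x by apply: lt_trans x1.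
have xZ : x \is a Num.int by exact: natr_int.
have [c cZ cE] := pfrac_decomp R _ x n xZ x1.
pose z := zeta_q1 (1 / x); pose A := \sum_(j < n.+1) pfrac_coef x n j.
pose B := \sum_(j < n.+1) pfrac_coef x n j * (\sum_(0 <= m < j.+1) (x ^+ m - 1)^-1)
  - \sum_(i < n) c i / (x ^+ (n - i) - 1).
have cE' t : pfrac_term x (x ^+ t.+1) n =
    \sum_(j < n.+1) pfrac_coef x n j / (x ^+ j * x ^+ t.+1 - 1) +
    \sum_(i < n) c i / x ^+ t.+1 ^+ (n - i).
  rewrite cE ?expf_neq0 ?gt_eqF // => j.
  by rewrite -exprD addnS gt_eqF // exprn_egt1.
have Slim : (\sum_(0 <= t < N) pfrac_term x (x ^+ t.+1) n @[N --> \oo] -->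
    A * z - B)%classic.
  rewrite /B opprB addrA [X in (_ --> X)%classic]addrAC.
  under eq_cvg => N do under eq_bigr => t _ do rewrite cE'.
  exact: cvg_pfrac_sum.
have Sge : x ^- (n + 'C(n.+1, 2) + n.+1 ^ 2) <= A * z - B.
  apply: ler_cvg_to (cvg_cst _) Slim _.
  by exists n.+1 => // N /= nN; have /andP[] := pfrac_sum_bounds _ _ _ _ x2 nN.
have Sle : A * z - B <= 2 / x ^+ (3 * 'C(n.+1, 2)).
  apply: ler_cvg_to Slim (cvg_cst _) _.
  by exists n.+1 => // N /= nN; have /andP[] := pfrac_sum_bounds _ _ _ _ x2 nN.
have aZ j : pfrac_coef x n j \is a Num.int.
  by rewrite !rpredM ?rpredX ?rpredN1 ?qbin_int.
have q0 : 0 < qfact x n by exact: qfact_gt0.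
exists (qfact x n * A), (qfact x n * B); rewrite -mulrA -mulrBr; split.
- rewrite rpredM ?rpred_sum //; apply: rpred_prod => i _.
  by rewrite rpredB ?rpred1 ?rpredX.
- rewrite mulrBr rpredB // mulr_sumr; apply: rpred_sum => -[j /= jn] _.
    rewrite mulrCA rpredM // mulr_sumr big_nat; apply: rpred_sum => -[|m] mj.
      by rewrite subrr invr0 mulr0 rpred0.
    by apply: qfact_dvd => //; lia.
  by rewrite mulrCA rpredM //; apply: qfact_dvd => //; lia.
- by rewrite normrM gtr0_norm // mulrC pfrac_coef_sum_le.
(* Here ['C(n, 2) - 'C(n+1, 2) = - n], which gives the exponent [n^2 + 4 n + 1]. *)
- apply: le_trans (ler_pM _ _ (qfact_ge _ _ x2 n) Sge); rewrite ?invr_ge0 ?exprn_ge0 ?(ltW x0) //.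
  rewrite ler_pdivlMr ?exprn_gt0 // ler_pdivrMl ?exprn_gt0 // -exprD ler_weXn2l ?(ltW x1) //.
  have := bin2_double n; case: (n) => [|k] // ; have := bin2_double k; nia.
- apply: le_trans (ler_pM _ _ (qfact_le _ _ x2 n) Sle) _.
  + exact: ltW.
  + by apply: le_trans Sge; rewrite invr_ge0 exprn_ge0 ?(ltW x0).
  rewrite mulrCA ler_pM2l // ler_pdivrMr ?exprn_gt0 // ler_pdivlMl ?exprn_gt0 //.
  by rewrite -exprD ler_weXn2l ?(ltW x1) //; have := bin2_double n; lia.
Qed.

(** * From linear forms to the irrationality measure *)

(* [156 = 12 * 13] makes the least [n] with [4 B < x^(n (n + 1))] at least [13], where
   [x^(2 n^2 + 9 n + 3) <= x^(3 (n (n - 1) - 2)) <= B^3].  If the integer [B C - a A] vanishes,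
   the lower bound on [A z - C] takes the place of its nonvanishing. *)
Lemma approx_of_linear_forms (R : archiRealFieldType) (x z a B : R) :
  2 <= x ->
  (forall n : nat, exists A C : R, [/\ A \is a Num.int, C \is a Num.int,
    `|A| <= x ^+ (2 * n ^ 2 + 4 * n),
    x ^- (n ^ 2 + 4 * n + 1) <= A * z - C & A * z - C <= 2 / x ^+ (n * n.+1)]) ->
  a \is a Num.int -> B \is a Num.int -> x ^+ 156 <= B ->
  1 / B ^+ 4 <= `|z - a / B|.
Proof.
move=> x2 forms aZ BZ Bge.
have x1 : 1 < x by apply: lt_le_trans x2; rewrite ltr1n.
have x0 : 0 < x by apply: lt_trans x1.
have B0 : 0 < B by apply: lt_le_trans Bge; rewrite exprn_gt0.
have le_pow i j : (i <= j)%N -> x ^+ i <= x ^+ j by move=> ij; rewrite ler_weXn2l // ltW.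
have exn : exists n, 4 * B < x ^+ (n * n.+1).
  have B4 : 0 <= 4 * B by rewrite mulr_ge0 // ltW.
  pose m := Num.bound (4 * B); exists m.
  apply: (@lt_le_trans _ _ (x ^+ m)); last by apply: le_pow; rewrite leq_pmulr.
  apply: lt_le_trans (archi_boundP B4) _; apply: (@le_trans _ _ (2 ^+ m)).
    by rewrite -natrX ler_nat ltnW // ltn_expl.
  by rewrite lerXn2r ?nnegrE // ltW.
case: (ex_minnP exn) => n nB nmin.
have n13 : (13 <= n)%N.
  rewrite ltnNge; apply/negP => n12.
  have : x ^+ (n * n.+1) <= B by apply: le_trans Bge; apply: le_pow; clear -n12; nia.
  lra.
(* Minimality of [n] gives [x^(n (n - 1)) <= 4 B], and [4 <= x^2]. *)
have Bn : x ^+ (n * n.-1 - 2) <= B.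
  have : x ^+ (n.-1 * n.-1.+1) <= 4 * B.
    by rewrite leNgt; apply/negP => /nmin; lia.
  rewrite prednK; last by lia.
  rewrite (_ : n.-1 * n = (n * n.-1 - 2) + 2)%N; last by nia.
  rewrite exprD => h; rewrite -(@ler_pM2r _ (x ^+ 2)) ?exprn_gt0 //.
  apply: le_trans h _; rewrite mulrC ler_pM2l // -[4](_ : 2 ^+ 2 = _); last by ring.
  by rewrite lerXn2r ?nnegrE // ltW.
have [A [C [AZ CZ Ale Lge Lle]]] := forms n.
(* The exponent is [(n^2 + 4 n + 1) - (n (n - 1) - 2)], from the case where the integer vanishes. *)
have key : x ^- (5 * n + 3) <= `|A * (B * z - a)|.
  rewrite [X in `|X|](_ : _ = B * (A * z - C) + (B * C - a * A)); last by ring.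
  have [->|W0] := eqVneq (B * C - a * A) 0.
    rewrite addr0; apply: le_trans (ler_norm _).
    apply: le_trans (ler_pM _ _ Bn Lge); rewrite ?invr_ge0 ?exprn_ge0 ?(ltW x0) //.
    rewrite ler_pdivlMr ?exprn_gt0 // ler_pdivrMl ?exprn_gt0 // -exprD.
    by apply: le_pow; clear -n13; case: n n13 => // n; nia.
  (* A nonzero integer has absolute value at least 1, while the choice of [n] keeps [B (A z - C)]
     within [1 / 2]. *)
  have WZ : B * C - a * A \is a Num.int by rewrite rpredB // rpredM.
  have W1 := norm_intr_ge1 WZ W0.
  have L0 : 0 <= B * (A * z - C).
    by rewrite mulr_ge0 ?(ltW B0) // (le_trans _ Lge) // invr_ge0 exprn_ge0 // ltW.
  have LB : B * (A * z - C) <= 1 / 2.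
    apply: (@le_trans _ _ (B * (2 / x ^+ (n * n.+1)))).
      by rewrite ler_pM2l.
    by rewrite mulrA ler_pdivrMr ?exprn_gt0 //; lra.
  have x12 : x ^- (5 * n + 3) <= 1 / 2.
    rewrite div1r lef_pV2 ?posrE ?exprn_gt0 //; apply: le_trans x2 _.
    by rewrite -[leLHS]expr1; apply: le_pow; rewrite addn3.
  have := ler_normB (B * (A * z - C) + (B * C - a * A)) (B * (A * z - C)).
  rewrite addrAC subrr add0r [`|B * (A * z - C)|]ger0_norm //; lra.
have {}key : x ^- (2 * n ^ 2 + 9 * n + 3) <= `|B * z - a|.
  move: key; rewrite normrM => key.
  have /(le_trans key) : `|A| * `|B * z - a| <= x ^+ (2 * n ^ 2 + 4 * n) * `|B * z - a|.
    by rewrite ler_wpM2r.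
  rewrite -ler_pdivrMl ?exprn_gt0 // -invfM -exprD => /(le_trans _) -> //.
  by rewrite lef_pV2 ?posrE ?exprn_gt0 //; apply: le_pow; clear; lia.
(* The comparison of exponents is [n^2 - 12 n - 9 >= 0], which holds from [n = 13] on. *)
have B3 : x ^+ (2 * n ^ 2 + 9 * n + 3) <= B ^+ 3.
  apply: (@le_trans _ _ ((x ^+ (n * n.-1 - 2)) ^+ 3)).
    by rewrite -exprM; apply: le_pow; clear -n13; case: n n13 => // n; nia.
  by rewrite lerXn2r ?nnegrE ?exprn_ge0 // ltW.
rewrite [z - _](_ : _ = (B * z - a) / B); last by field; rewrite gt_eqF.
rewrite normrM normfV (gtr0_norm B0) ler_pdivlMr // exprSr invfM mulrA.
rewrite mulfVK ?gt_eqF // div1r; apply: le_trans key.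
by rewrite lef_pV2 ?posrE ?exprn_gt0.
Qed.

(** Only denominators [b < K] remain, and [0 <= r] forces [|z - a / b| < 1], so
    [|a| < K (|z| + 1)]. *)
Lemma finite_bounded_solutions (R : realType) (z : R) (r : R) (K : nat) :
  0 <= r -> (forall a b : int, 0 < b -> K%:R <= b%:~R :> R ->
    1 / b%:~R `^ r <= `|z - a%:~R / b%:~R|) ->
  finite_set (approx_solutions z r).
Proof.
move=> r0 far; pose M := Num.bound (K%:R * (`|z| + 1)).
(* Shifting by [M] enumerates the integers from [- M] to [M - 1] by naturals below [M + M]. *)
apply: (@sub_finite_set _ _ [set ((ij.1 : int) - M%:Z, ij.2 : int) |
    ij in (`I_(M + M) `*` `I_K)]%classic); last first.
  by apply: finite_image; apply: finite_setX; exact: finite_II.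
move=> [a [b|b]] [//= b0 ab]; have B0 : 0 < (b%:~R : R) by rewrite ltr0z.
have bK : (b < K)%N.
  rewrite ltnNge; apply/negP => Kb; move: ab; rewrite ltNge => /negP; apply.
  by apply: far => //; rewrite ler_nat.
have B1 : 1 <= (b%:~R : R) by rewrite (ler_int _ 1).
have ab1 : `|z - a%:~R / b%:~R| < 1.
  apply: lt_le_trans ab _; rewrite div1r invf_le1 ?powR_gt0 //.
  by have := ler_powR B1 r0; rewrite powRr0.
have aM : `|a%:~R : R| < M%:R.
  apply: le_lt_trans (archi_boundP _); last by rewrite mulr_ge0 // addr_ge0.
  apply: (@le_trans _ _ (b%:R * (`|z| + 1))); last first.
    by rewrite ler_wpM2r ?addr_ge0 // ler_nat ltnW.
  rewrite -ler_pdivrMl // -[X in X^-1 * _](gtr0_norm B0) -normfV -normrM mulrC.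
  by have := ler_normB z (z - a%:~R / b%:~R); rewrite subKr; lra.
rewrite -intr_norm -[M%:R]/(M%:~R) ltr_int in aM.
exists (absz (a + M%:Z), b) => /=; last by congr (_, _); lia.
by split => //=; lia.
Qed.

Lemma pi_sq_bounds (R : realType) : 4 < pi ^+ 2 :> R /\ pi ^+ 2 <= 16 :> R.
Proof.
have h2 := pihalf_lt2 R; have h1 := pihalf_ge1 R.
(* Strictness comes from [cos 1 > 0 = cos (pi / 2)]. *)
have hne : pi / 2 != 1 :> R.
  by apply/eqP => h; have := cos1_gt0 R; rewrite -h cos_pihalf ltxx.
have hgt : 1 < pi / 2 :> R by rewrite lt_neqAle eq_sym hne.
by move: hgt h2; set y : R := pi => hgt h2; split; nra.
Qed.

Theorem mainTheorem4 (R : realType) (p : nat) (q : R)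
    (hp : (2 <= p)%N) (hq : q = 1 / p%:R) :
  (irrationality_measure (zeta_q1 q) <= (3 * pi ^+ 2 / (pi ^+ 2 - 4))%:E)%E.
Proof.
rewrite hq; apply: ereal_inf_le; exists 4%:E; last first.
  (* With a positive denominator, [4 <= 3 pi^2 / (pi^2 - 4)] amounts to [pi^2 <= 16]. *)
  have [pi4 pi16] := pi_sq_bounds R.
  by rewrite lee_fin ler_pdivlMr ?subr_gt0 //; lra.
exists 4 => //=; apply: (@finite_bounded_solutions _ _ _ (p ^ 156)) => // a b b0 Kb.
rewrite powR_mulrn ?ler0z ?(ltW b0) //.
apply: (approx_of_linear_forms _ p%:R); rewrite ?intr_int ?ler_nat -?natrX //.
by move=> n; exact: zeta_q1_linear_form.
Qed.
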